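(* For every positive integer $m$, the linear coefficient $d_1(m)$ of $P_m(a)$ satisfies $$\nu_2(d_1(m)) = 1 - 2m + \nu_2\left(\binom{m+1}{2}\right) + s_2(m).$$
   Context: For a positive integer $m$ and real $a > -1$, let $N_{0,4}(a;m) = \int_0^\infty \frac{dx}{(x^4+2ax^2+1)^{m+1}}$. The function $P_m(a) = \frac{2^{m+3/2}}{\pi}(a+1)^{m+1/2} N_{0,4}(a;m)$ is a polynomial of degree $m$ in $a$ with rational coefficients; write $P_m(a) = \sum_{l=0}^m d_l(m) a^l$. $\nu_2$ denotes the $2$-adic valuation of a nonzero rational number, and $s_2(m)$ is the sum of the binary digits of $m$. *)

(* Defs.v *)
(* MathComp-Analysis; the reals are an arbitrary [R : realType]. *)
From mathcomp Require Import all_boot all_order all_algebra.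
From mathcomp Require Import all_classical all_reals all_analysis.

Set Implicit Arguments.
Unset Strict Implicit.
Unset Printing Implicit Defensive.

Import Order.TTheory GRing.Theory Num.Theory.
Import numFieldNormedType.Exports.

Local Open Scope classical_set_scope.
Local Open Scope ring_scope.

Definition N04 (R : realType) (m : nat) (a : R) : R :=
  \int[lebesgue_measure]_(x in `[0, +oo[)
    ((x ^+ 4 + 2 * a * x ^+ 2 + 1) ^+ m.+1)^-1.

Definition Pfun (R : realType) (m : nat) (a : R) : R :=
  2 `^ (m%:R + 3 / 2) / pi * (a + 1) `^ (m%:R + 1 / 2) * N04 m a.

Definition represents_P (R : realType) (m : nat) (p : {poly rat}) : Prop :=
  size p = m.+1 /\
  forall a : R, -1 < a -> Pfun m a = (map_poly ratr p).[a].

(* There is exactly one polynomial to choose: one exists for every positive m,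
   and two polynomials that agree on ]-1, +oo[ are equal.  The default 0 never
   satisfies [represents_P], because its size is 0. *)
Definition Ppoly (R : realType) (m : nat) : {poly rat} :=
  xget 0 [set p | represents_P R m p].

Definition d (R : realType) (l m : nat) : rat := (Ppoly R m)`_l.

(* The 2-adic valuation of a nonzero rational; nu2 0 = 0 is a junk value. *)
Definition nu2 (q : rat) : int :=
  (logn 2 `|numq q|%N)%:Z - (logn 2 `|denq q|%N)%:Z.

(* The binary digits of m at positions i >= m are all 0, since m < 2 ^ m. *)
Definition s2 (m : nat) : nat := (\sum_(i < m) (m %/ 2 ^ i) %% 2)%N.

(* Main.v *)
(* Put c = 2 (a + 1) and y = x - 1/x.  Folding the integral along x -> 1/x
   turns it into the integral over y > 0 of U_m(y) / (y^2 + c)^(m+1), where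
   U_m(x - 1/x) = (x^(2m+1) + x^-(2m+1)) / (x + 1/x)
                = sum_j C(m+j, 2j) (x - 1/x)^(2j),
   and the integrals of y^(2j) / (y^2 + c)^(m+1) are products of double
   factorials.  This gives
   P_m(a) = sum_j C(m+j, 2j) (2j-1)!! (2m-2j-1)!! / (2^m m!) 2^j (a + 1)^j,
   whose linear coefficient is m (m+1) A / (2^m m!) with
   A = sum_(1 <= j <= m) (2m-2j-1)!! (j-1)! C(m+j, j-1) C(m-1, j-1).
   The term j = 1 of A is odd and all others are even, so A is odd and the
   valuation follows from Legendre's formula for m!. *)
Require Import Defs.
From mathcomp Require Import all_boot all_order all_algebra.
From mathcomp Require Import all_classical all_reals all_analysis.
From mathcomp Require Import ring lra zify.
Set Implicit Arguments.
Unset Strict Implicit.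
Unset Printing Implicit Defensive.

Import Order.TTheory GRing.Theory Num.Theory.
Import numFieldNormedType.Exports.
Local Open Scope classical_set_scope.
Local Open Scope ring_scope.

(* dfact n = (2n - 1)!! *)
Fixpoint dfact n : nat := if n is k.+1 then ((2 * k).+1 * dfact k)%N else 1%N.

(** * 2-adic valuations of quotients and factorials *)

(** The fraction a / b may not be in lowest terms; cross-multiplying it with the reduced one gives
    an identity in [nat], to which [logn] applies. *)
Lemma nu2_div (a b : nat) : (0 < a)%N -> (0 < b)%N ->
  nu2 (a%:R / b%:R) = (logn 2 a)%:Z - (logn 2 b)%:Z.
Proof.
move=> a0 b0; rewrite /nu2; set q : rat := a%:R / b%:R.
have b0' : b%:R != 0 :> rat by rewrite pnatr_eq0 -lt0n.
have q0 : q != 0 by rewrite mulf_neq0 ?invr_eq0 // pnatr_eq0 -lt0n.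
have nq0 : (0 < `|numq q|)%N by rewrite absz_gt0 numq_eq0.
have dq0 : (0 < `|denq q|)%N by rewrite absz_gt0 denq_eq0.
have : (`|numq q| * b = a * `|denq q|)%N.
  have : (numq q * b%:Z)%:~R = (a%:Z * denq q)%:~R :> rat.
    rewrite !rmorphM /= numqE -!pmulrn /q.
    by rewrite mulrAC divfK // mulrC.
  by move=> /intr_inj /(congr1 absz); rewrite !abszM.
move=> /(congr1 (logn 2)); rewrite !lognM //; lia.
Qed.

(** Legendre's formula. Let A be the sum of the floors of m / 2^(i+1) for i < m. The sum of the
    floors of m / 2^i is m + A by shifting the index (the term i = m is 0), and 2A + s2(m) by
    dividing each floor by 2. *)
Lemma logn2_fact m : (logn 2 m`! + s2 m = m)%N.
Proof.
rewrite logn_fact // /s2 big_add1 /= big_mkord.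
have -> : (\sum_(i < m) m %/ 2 ^ i.+1 = \sum_(i < m) (m %/ 2 ^ i) %/ 2)%N.
  by apply: eq_bigr => i _; rewrite -divnMA expnSr.
have H : (\sum_(i < m) m %/ 2 ^ i =
    2 * (\sum_(i < m) (m %/ 2 ^ i) %/ 2) + \sum_(i < m) (m %/ 2 ^ i) %% 2)%N.
  rewrite big_distrr -big_split /=; apply: eq_bigr => i _.
  by rewrite mulnC -divn_eq.
have T : (\sum_(i < m) m %/ 2 ^ i = m + \sum_(i < m) (m %/ 2 ^ i) %/ 2)%N.
  have -> : (\sum_(i < m) (m %/ 2 ^ i) %/ 2 = \sum_(i < m) m %/ 2 ^ i.+1)%N.
    by apply: eq_bigr => i _; rewrite -divnMA expnSr.
  have : (\sum_(i < m.+1) m %/ 2 ^ i = \sum_(i < m) m %/ 2 ^ i)%N.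
    rewrite big_ord_recr /= [X in (_ + X)%N]divn_small ?addn0 //.
    exact: ltn_expl.
  by rewrite big_ord_recl /= expn0 divn1 => <-.
move: H; rewrite T.
by move: (\sum_(i < m) _ %/ 2)%N (\sum_(i < m) _ %% 2)%N => A B; lia.
Qed.

(** * Arithmetic of the linear coefficient *)

(** The sum A of the overview, with its index shifted to start at 0. *)
Definition oddsum m :=
  (\sum_(j < m) dfact (m - j.+1) * j`! * 'C(m + j.+1, j) * 'C(m.-1, j))%N.

Lemma odd_dfact n : odd (dfact n).
Proof. by elim: n => //= n IHn; rewrite oddM IHn /= oddM. Qed.

(** The term j = 0 is a double factorial. The term j = 1 contains (m + 2)(m - 1), whose factors have
    opposite parity. For j >= 2 the factor j! is even. *)
Lemma odd_oddsum m : (0 < m)%N -> odd (oddsum m).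
Proof.
case: m => // m _; rewrite /oddsum big_ord_recl oddD.
rewrite !oddM odd_dfact /= !bin0 [X in _ (+) X](_ : _ = false) //.
apply/negbTE; rewrite -dvdn2; apply: dvdn_sum => -[[|i] ltim] _ /=.
  rewrite /bump /= !bin1 dvdn2 !oddM; lia.
have fact_even : (2 %| i.+2`!)%N by apply: dvdn_fact.
by rewrite -mulnA dvdn_mulr // dvdn_mull.
Qed.

Lemma dfact_fact n : (2 ^ n * n`! * dfact n = (2 * n)`!)%N.
Proof.
elim: n => //= n IHn; rewrite mulnS !factS -IHn expnS; nia.
Qed.

(** With k = j + 1, both sides become k (m + k)! once multiplied by k! (m - k)!. *)
Lemma linear_coef_term m j : (j < m)%N ->
  (j.+1 * (2 ^ j.+1 * ('C(m + j.+1, 2 * j.+1) * dfact j.+1))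
   = m * m.+1 * (j`! * 'C(m + j.+1, j) * 'C(m.-1, j)))%N.
Proof.
move=> ltjm; set k := j.+1.
apply/eqP; rewrite -(@eqn_pmul2r (k`! * (m - k)`!)) ?muln_gt0 ?fact_gt0 //; apply/eqP.
have E1 : ('C(m + k, 2 * k) * ((2 * k)`! * (m - k)`!) = (m + k)`!)%N.
  rewrite -(@bin_fact (m + k) (2 * k)); last by rewrite /k; lia.
  by congr (_ * (_ * _`!))%N; lia.
have E2 : ('C(m + k, j) * (j`! * m.+1`!) = (m + k)`!)%N.
  rewrite -(@bin_fact (m + k) j); last by rewrite /k; lia.
  by congr (_ * (_ * _`!))%N; rewrite /k; lia.
have E3 : ('C(m.-1, j) * (j`! * (m - k)`!) = m.-1`!)%N.
  rewrite -(@bin_fact m.-1 j); last by lia.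
  by congr (_ * (_ * _`!))%N; rewrite /k; lia.
have E4 : (m.+1`! = m.+1 * m * m.-1`!)%N.
  by case: (m) ltjm => // n _; rewrite !factS /=; nia.
have E5 : (k`! = k * j`!)%N by rewrite /k factS.
transitivity (k * (m + k)`!)%N.
  by rewrite -E1 -(dfact_fact k); ring.
by rewrite -E2 E4 -E3 E5; ring.
Qed.

(** The leading factor [j] is the linear coefficient of (a + 1)^j. *)
Lemma sum_linear_coef m : (0 < m)%N ->
  (\sum_(j < m.+1) j * (2 ^ j * ('C(m + j, 2 * j) * (dfact j * dfact (m - j))))
   = m * m.+1 * oddsum m)%N.
Proof.
move=> m0; rewrite big_ord_recl mul0n add0n /oddsum big_distrr.
apply: eq_bigr => j _; rewrite lift0.
transitivity (dfact (m - j.+1) *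
  (j.+1 * (2 ^ j.+1 * ('C(m + j.+1, 2 * j.+1) * dfact j.+1))))%N; first by ring.
by rewrite (linear_coef_term (ltn_ord j)) /=; ring.
Qed.

(** * The explicit polynomial, in powers of 2 (a + 1) *)

Definition Pexplicit m : {poly rat} := \sum_(j < m.+1)
  (('C(m + j, 2 * j) * (dfact j * dfact (m - j)))%:R / (2 ^ m * m`!)%:R) *:
    (2%:R *: ('X + 1%:P)) ^+ j.

Lemma dfact_gt0 n : (0 < dfact n)%N.
Proof. by apply: odd_gt0; exact: odd_dfact. Qed.

Lemma size_Pexplicit m : size (Pexplicit m) = m.+1.
Proof.
have sj j : size ((2%:R *: ('X + 1%:P)) ^+ j : {poly rat}) = j.+1.
  have p0 : 'X + 1%:P != 0 :> {poly rat} by rewrite -size_poly_eq0 size_XaddC.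
  rewrite exprZn size_scale ?expf_neq0 // -[LHS]prednK.
    by rewrite size_exp size_XaddC mul1n.
  by rewrite lt0n size_poly_eq0 expf_neq0.
have cn0 a b : (0 < a)%N -> (0 < b)%N -> a%:R / b%:R != 0 :> rat.
  by move=> a0 b0; rewrite mulf_neq0 ?invr_eq0 // pnatr_eq0 -lt0n.
rewrite /Pexplicit big_ord_recr /= addrC size_polyDl.
  rewrite size_scale ?sj // cn0 // !muln_gt0 ?expn_gt0 ?fact_gt0 ?dfact_gt0 ?bin_gt0 //.
  by rewrite andbT; lia.
rewrite size_scale ?sj; last first.
  rewrite cn0 // !muln_gt0 ?expn_gt0 ?fact_gt0 ?dfact_gt0 ?bin_gt0 //.
  by rewrite andbT; lia.
apply: leq_trans (size_sum _ _ _) _; apply/bigmax_leqP => j _.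
by rewrite (leq_trans (size_scale_leq _ _)) // sj.
Qed.

Lemma Pexplicit1 m : (0 < m)%N ->
  (Pexplicit m)`_1 = (m * m.+1 * oddsum m)%:R / (2 ^ m * m`!)%:R.
Proof.
move=> m0; rewrite -sum_linear_coef // natr_sum mulr_suml coef_sum.
apply: eq_bigr => j _; rewrite coefZ exprZn coefZ.
have -> : (('X + 1%:P) ^+ j : {poly rat})`_1 = j%:R.
  (* The linear coefficient is the value at 0 of the derivative. *)
  rewrite -[_`_1]mulr1n -(coef_deriv _ 0) deriv_exp derivD derivX derivC addr0.
  by rewrite mul1r -horner_coef0 hornerMn horner_exp !hornerE expr1n.
by rewrite !natrM !natrX; ring.
Qed.

(** * Primitives and improper integrals on the half-line *)

Section Integral.
Variable R : realType.
Implicit Types (f g F G : R -> R) (x y z c l : R).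

Lemma exists_primitive f : continuous f ->
  exists F, forall x, -1 < x -> is_derive x 1 F (f x).
Proof.
move=> cf.
(* The base point -1, rather than 0, makes the primitive continuous on both sides of 0, where the
   folding argument takes its limit. *)
exists (fun x => \int[lebesgue_measure]_(t in `[-1, x]) f t) => x x_gt.
have xu : x < x + 1 by rewrite ltrDl.
have intf : lebesgue_measure.-integrable `[-1, x + 1] (EFin \o f).
  apply: continuous_compact_integrable; first exact: segment_compact.
  exact: continuous_subspaceT.
have [dF F'] := continuous_FTC1_closed xu intf x_gt (cf x).
by split; [exact: dF | rewrite -derive1E; exact: F'].
Qed.

(* An elementary form of [\int_0^oo g = l]: linearity needs no integrability. *)
Definition has_integral0y g l := exists G,
  [/\ forall y, is_derive y 1 G (g y), G 0 = 0 & G y @[y --> +oo] --> l].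

Lemma has_integral0y_eq g g' l l' : g =1 g' -> l = l' ->
  has_integral0y g l -> has_integral0y g' l'.
Proof. by move=> /funext -> ->. Qed.

Lemma has_integral0yZ k g l :
  has_integral0y g l -> has_integral0y (fun y => k * g y) (k * l).
Proof.
move=> [G [dG G0 Gl]]; exists (fun y => k * G y); split.
- by move=> y; have := dG y => ?; apply: is_deriveZ.
- by rewrite G0 mulr0.
- exact: cvgMr.
Qed.

Lemma has_integral0yD g1 g2 l1 l2 : has_integral0y g1 l1 ->
  has_integral0y g2 l2 -> has_integral0y (fun y => g1 y + g2 y) (l1 + l2).
Proof.
move=> [G1 [dG1 G10 Gl1]] [G2 [dG2 G20 Gl2]].
exists (fun y => G1 y + G2 y); split.
- by move=> y; apply: is_deriveD.
- by rewrite G10 G20 addr0.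
- exact: cvgD.
Qed.

Lemma has_integral0y_sum n (g : 'I_n -> R -> R) (l : 'I_n -> R) :
  (forall j, has_integral0y (g j) (l j)) ->
  has_integral0y (fun y => \sum_(j < n) g j y) (\sum_(j < n) l j).
Proof.
elim: n g l => [|n IHn] g l gl.
  exists (fun=> 0); split => [y||]; rewrite ?big_ord0 //.
    exact: is_derive_cst.
  exact: cvg_cst.
rewrite big_ord_recl; under eq_fun do rewrite big_ord_recl.
exact: has_integral0yD (gl ord0)
  (IHn _ _ (fun j : 'I_n => gl (lift ord0 j))).
Qed.

(** * Integrals of y^(2j) / (y^2 + c)^(n+1) *)

Lemma is_derive1X f k x (df : R) : is_derive x 1 f df ->
  is_derive x 1 (fun y => f y ^+ k) (k%:R * f x ^+ k.-1 * df).
Proof.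
move=> dfx; have -> : (fun y => f y ^+ k) = f ^+ k.
  by apply/funext => y; rewrite exprfctE.
exact: is_deriveX.
Qed.

Lemma is_derive1M f g x (df dg : R) : is_derive x 1 f df -> is_derive x 1 g dg ->
  is_derive x 1 (fun y => f y * g y) (df * g x + f x * dg).
Proof.
move=> dfx dgx; apply: (is_derive_eq (is_deriveM _ _)).
by rewrite /GRing.scale/= addrC [g x * _]mulrC.
Qed.

Lemma is_derive1V f x (df : R) : f x != 0 -> is_derive x 1 f df ->
  is_derive x 1 (fun y => (f y)^-1) (- df / f x ^+ 2).
Proof.
move=> fx0 dfx; apply: (is_derive_eq (is_deriveV _ _)) => //.
by rewrite /GRing.scale/= !mulNr mulrC.
Qed.

(** Integration by parts: this derivative links the integrands with exponents (j, n) and (j + 1, n +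
    1), and its primitive vanishes at 0 and, for j <= n, at infinity. *)
Lemma is_derive_oddXV (j n : nat) c y : 0 < c ->
  is_derive y 1 (fun y => y ^+ (2 * j).+1 / (y ^+ 2 + c) ^+ n.+1)
    ((2 * j).+1%:R * (y ^+ (2 * j) / (y ^+ 2 + c) ^+ n.+1)
     - (2 * n.+1)%:R * (y ^+ (2 * j.+1) / (y ^+ 2 + c) ^+ n.+2)).
Proof.
move=> c0.
have w0 : y ^+ 2 + c != 0 by rewrite gt_eqF // ltr_wpDl // sqr_ge0.
have dw : is_derive y 1 (fun y => y ^+ 2 + c) (2%:R * y).
  apply: (is_derive_eq (is_deriveD
    (is_derive1X 2 (is_derive_id _ _)) (is_derive_cst _ _ _))).
  by rewrite addr0 mulr1 expr1.
apply: (is_derive_eq (is_derive1M (is_derive1X _ (is_derive_id _ _))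
  (is_derive1V _ (is_derive1X n.+1 dw)))); first by rewrite expf_neq0.
rewrite !mulr1 /= mulNr mulrA mulrN mulrA; congr (_ - _).
  by rewrite mulrA.
rewrite natrM (_ : (2 * j.+1 = (2 * j).+2)%N); last by lia.
rewrite !(exprS _ n.+1) !(exprS _ n) !(exprS _ (2 * j).+1) !(exprS _ (2 * j)).
set W := (_ + c) ^+ n; set Y := y ^+ (2 * j).
have W0 : W != 0 by rewrite expf_neq0.
by field; rewrite W0 w0.
Qed.

Lemma cvgy_oddXV (j n : nat) c : 0 < c -> (j <= n)%N ->
  (y : R) ^+ (2 * j).+1 / (y ^+ 2 + c) ^+ n.+1 @[y --> +oo] --> 0.
Proof.
move=> c0 jn.
(* For y >= 1, y^(2j+2) <= (y^2)^(n+1) <= (y^2 + c)^(n+1), so the quotient is at most 1/y. *)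
apply: (@squeeze_cvgr _ _ _ _ (fun=> 0) (fun y => y^-1)).
- near=> y.
  have y1 : 1 <= y by near: y; exact: nbhs_pinfty_ge.
  have y0 : 0 < y by apply: lt_le_trans y1.
  have w0 : 0 < y ^+ 2 + c by rewrite ltr_wpDl // sqr_ge0.
  apply/andP; split; first by rewrite divr_ge0 ?exprn_ge0 ?ltW.
  rewrite ler_pdivrMr ?exprn_gt0 // mulrC ler_pdivlMr // -exprSr.
  apply: (@le_trans _ _ ((y ^+ 2) ^+ n.+1)).
    by rewrite -exprM ler_weXn2l //; lia.
  by rewrite lerXn2r ?nnegrE ?sqr_ge0 ?(ltW w0) // lerDl ltW.
- exact: cvg_cst.
- apply/gtr0_cvgV0; last exact: cvg_id.
  by near=> y; near: y; exact: nbhs_pinfty_gt.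
Unshelve. all: by end_near. Qed.

Lemma has_integral0y_base c : 0 < c ->
  has_integral0y (fun y => (y ^+ 2 + c)^-1) (pi / 2 / Num.sqrt c).
Proof.
move=> c0; set s := Num.sqrt c.
have s0 : 0 < s by rewrite sqrtr_gt0.
have cE : c = s ^+ 2 by rewrite sqr_sqrtr // ltW.
exists (fun y => s^-1 * atan (s^-1 * y)); split.
- move=> y.
  have d1 : is_derive y 1 (fun y => s^-1 * y) (s^-1).
    by apply: (is_derive_eq (is_deriveZ _ _)); rewrite /GRing.scale/= mulr1.
  apply: (is_derive_eq (is_deriveZ _ (is_derive1_comp (is_derive1_atan _) d1))).
  rewrite /GRing.scale/= cE; field.
  by rewrite -cE !gt_eqF // ltr_wpDl // sqr_ge0.
- by rewrite mulr0 atan0 mulr0.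
- rewrite mulrC; apply: cvgMr.
  apply: (@cvg_comp _ _ _ (fun y => s^-1 * y) (@atan R) _ (pinfty_nbhs R));
    last exact: cvgy_atan.
  apply/cvgryPge => A; near=> y.
  by rewrite mulrC ler_pdivlMr //; near: y; exact: nbhs_pinfty_ge.
Unshelve. all: by end_near. Qed.

(** Writing the exponent as j + k lets k grow first at j = 0, from the arctangent integral, and then
    j grow at fixed k. *)
Lemma has_integral0y_quot (c : R) (j k : nat) : 0 < c ->
  has_integral0y (fun y => y ^+ (2 * j) / (y ^+ 2 + c) ^+ (j + k).+1)
    (pi / 2 / Num.sqrt c / c ^+ k * (dfact j * dfact k)%:R
      / (2 ^ (j + k) * (j + k)`!)%:R).
Proof.
move=> c0.
have Gbdry i n : (i <= n)%N -> has_integral0y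
    (fun y => (2 * i).+1%:R * (y ^+ (2 * i) / (y ^+ 2 + c) ^+ n.+1)
     - (2 * n.+1)%:R * (y ^+ (2 * i.+1) / (y ^+ 2 + c) ^+ n.+2)) 0.
  move=> le_in; exists (fun y => y ^+ (2 * i).+1 / (y ^+ 2 + c) ^+ n.+1); split.
  - by move=> y; apply: is_derive_oddXV.
  - by rewrite expr0n mul0r.
  - exact: cvgy_oddXV.
have c00 : c != 0 by rewrite gt_eqF.
have s00 : Num.sqrt c != 0 by rewrite gt_eqF ?sqrtr_gt0.
have fact_nz n : n`!%:R != 0 :> R by rewrite pnatr_eq0 -lt0n fact_gt0.
have exp_nz n : (2 ^ n)%:R != 0 :> R by rewrite pnatr_eq0 -lt0n expn_gt0.
have w0 y : y ^+ 2 + c != 0 by rewrite gt_eqF // ltr_wpDl // sqr_ge0.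
have nz n : 1 + n%:R != 0 :> R by rewrite nat1r pnatr_eq0.
elim: j => [|j IHj].
  elim: k => [|k IHk].
    apply: has_integral0y_eq (has_integral0y_base c0) => [y|].
      by rewrite expr0 expr1 mul1r.
    by rewrite /= fact0 expr0 invr1 !mulr1.
  (* With w = y^2 + c, adding the exact derivative to (2k + 1) / w^(k+1) leaves 2 (k + 1) c /
     w^(k+2), because w - y^2 = c. *)
  apply: has_integral0y_eq (has_integral0yZ ((2 * k.+1)%:R * c)^-1
    (has_integral0yD (has_integral0yZ (2 * k).+1%:R IHk)
      (Gbdry 0%N k (leq0n k)))) => [y|].
    rewrite !add0n muln0 muln1 [(y ^+ 2 + c) ^+ k.+2]exprS natrM.
    set W := (y ^+ 2 + c) ^+ k.+1.
    have W0 : W != 0 by rewrite expf_neq0.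
    have -> : (2 * k).+1%:R = 2%:R * k.+1%:R - 1 :> R.
      by rewrite -[(2 * k).+1%:R]natr1 natrM -[k.+1%:R]natr1; ring.
    by field; rewrite nz W0 w0 c00.
  rewrite addr0 !add0n factS expnS exprS !natrM.
  by field; rewrite fact_nz nz exp_nz expf_neq0 // c00 s00.
(* Here the derivative identity is solved for its subtracted term. *)
apply: has_integral0y_eq (has_integral0yZ (2 * (j + k).+1)%:R^-1
    (has_integral0yD (has_integral0yZ (2 * j).+1%:R IHj)
      (has_integral0yZ (-1) (Gbdry j (j + k)%N (leq_addr k j))))) => [y|].
  rewrite addSn.
  by field; rewrite !expf_neq0 // -natrD nz.
rewrite mulr0 addr0 addSn factS expnS !natrM.
by field; rewrite fact_nz -natrD nz exp_nz expf_neq0.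
Qed.

(** * Folding along x -> 1/x *)

Lemma constant_of_derive0 (H : R -> R) x y : 0 < x -> 0 < y ->
  (forall z, 0 < z -> is_derive z 1 H 0) -> H x = H y.
Proof.
wlog xy : x y / x <= y.
  by move=> W x0 y0 dH; have /orP[xy|yx] := le_total x y; [|apply/esym]; exact: W.
move=> x0 y0 dH.
have [z||z _] := @MVT_segment R H (fun=> 0) x y xy.
- by rewrite in_itv /= => /andP[xz _]; apply: dH; exact: lt_trans xz.
- apply: continuous_in_subspaceT => z; rewrite inE /= in_itv /= => /andP[xz _].
  have [dHz _] := dH z (lt_le_trans x0 xz).
  exact/differentiable_continuous/derivable1_diffP.
- by rewrite mul0r => /eqP; rewrite subr_eq0 => /eqP.
Qed.

(* Folding by x -> 1/x: if F' = f, the function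
   F x - F (1/x) - G (x - 1/x) has derivative 0 and vanishes at 1. *)
Lemma Rintegral_fold_inv f g l : continuous f -> (forall x, 0 <= f x) ->
  has_integral0y g l ->
  (forall x, 0 < x -> f x + f x^-1 / x ^+ 2 = (1 + (x ^+ 2)^-1) * g (x - x^-1)) ->
  \int[lebesgue_measure]_(x in `[0, +oo[) f x = l.
Proof.
move=> cf f_ge0 [G [dG G0 Gl]] fg; have [F dF] := exists_primitive cf.
have cF x : -1 < x -> {for x, continuous F}.
  by move=> /dF[dFx _]; exact/differentiable_continuous/derivable1_diffP.
have FG x : 0 < x -> F x = F x^-1 + G (x - x^-1).
  move=> x0; pose H x := F x - F x^-1 - G (x - x^-1).
  suff : H x = H 1.
    rewrite /H invr1 !subrr G0 subr0 => /eqP.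
    by rewrite -addrA -opprD subr_eq0 => /eqP.
  apply: constant_of_derive0 => // z z0.
  have z'0 : 0 < z^-1 by rewrite invr_gt0.
  have dV : is_derive z 1 (fun x : R => x^-1) (- 1 / z ^+ 2).
    by apply: is_derive1V; rewrite ?gt_eqF //; exact: is_derive_id.
  have dFz := dF z (lt_trans (ltrN10 _) z0).
  have dFV := is_derive1_comp (dF _ (lt_trans (ltrN10 _) z'0)) dV.
  have dGz := is_derive1_comp (dG _) (is_deriveB (is_derive_id z 1) dV).
  apply: (is_derive_eq (is_deriveB (is_deriveB dFz dFV) dGz)).
  have := fg z z0; rewrite -[_^-1]/(z^-1).
  rewrite mulN1r mulrN !opprK => ->.
  by rewrite mulrC subrr.
(* As x tends to infinity, F(1/x) tends to F(0) and G(x - 1/x) to l, so F has limit F(0) + l. *)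
rewrite (@Rintegral_ge0_continuous_FTC2y _ f F 0 (F 0 + l)).
- by rewrite addrAC subrr add0r.
- by move=> x _.
- exact: continuous_subspaceT.
- have Vy : x^-1 @[x --> +oo] --> (0 : R).
    apply/gtr0_cvgV0; last exact: cvg_id.
    by near=> y; near: y; exact: nbhs_pinfty_gt.
  have : F x^-1 + G (x - x^-1) @[x --> +oo] --> F 0 + l.
    apply: cvgD.
      by apply: (cvg_comp _ _ Vy); apply: cF.
    apply: (@cvg_comp _ _ _ (fun x : R => x - x^-1) G _ (pinfty_nbhs R)) => //.
    apply/cvgryPge => A; near=> x.
    rewrite lerBrDr; apply: (@le_trans _ _ (A + 1)).
      rewrite lerD2l invf_le1; last by near: x; exact: nbhs_pinfty_gt.
      by near: x; exact: nbhs_pinfty_ge.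
    by near: x; apply: nbhs_pinfty_ge; exact: num_real.
  apply: cvg_trans; apply: near_eq_cvg; near=> x.
  by apply/esym/FG; near: x; exact: nbhs_pinfty_gt.
- by move=> x x0; have [] := dF x (lt_trans (ltrN10 _) x0).
- by apply: cvg_at_right_filter; apply: cF; rewrite ltrN10.
- move=> x; rewrite in_itv /= andbT => x0.
  by rewrite derive1E; have [_ ->] := dF x (lt_trans (ltrN10 _) x0).
Unshelve. all: by end_near. Qed.

(* Pascal's rule couples the even and odd binomial sums, so the induction on m
   needs both identities. *)
Lemma sum_bin_sub_inv (x : R) m N : x != 0 -> (m < N)%N ->
  (x + x^-1) * (\sum_(j < N) 'C(m + j, 2 * j)%:R * (x - x^-1) ^+ (2 * j))
    = x ^+ (2 * m).+1 + x ^- (2 * m).+1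
  /\
  (x + x^-1) * (x - x^-1) *
      (\sum_(j < N) 'C(m + j, (2 * j).+1)%:R * (x - x^-1) ^+ (2 * j))
    = x ^+ (2 * m) - x ^- (2 * m).
Proof.
move=> x0; set y := x - x^-1.
(* [N] is generalized because the index shift in the even sum uses up one term. *)
elim: m N => [|m IHm] [//|N] mN.
  rewrite !big_ord_recl !big1 => [|i _|i _].
  - rewrite muln0 !bin0 bin0n /= !expr0 expr1 !addr0 invr1.
    by rewrite mulr1 mul0r mulr0 subrr mulr1.
  - by rewrite bin_small ?mul0r // lift0; lia.
  - by rewrite bin_small ?mul0r // lift0; lia.
(* Pascal's rule writes the odd sum at m + 1 as the sum of the odd and the even sums at m. *)
have VS M : (m < M)%N -> (x + x^-1) * y *
      (\sum_(j < M) 'C(m.+1 + j, (2 * j).+1)%:R * y ^+ (2 * j))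
    = x ^+ (2 * m.+1) - x ^- (2 * m.+1).
  move=> mM; have [IHU IHV] := IHm M mM.
  under eq_bigr do rewrite addSn binS natrD mulrDl.
  rewrite big_split mulrDr IHV /= -mulrA [y * _]mulrC mulrA IHU.
  rewrite (_ : (2 * m.+1 = (2 * m).+2)%N); last by lia.
  by rewrite /y !exprS; field; rewrite expf_neq0.
split; last by apply: VS; lia.
case: N mN => [//|N] mN.
(* For j >= 1, Pascal's rule splits the even sum at m + 1 into the even sum at m and y^2 times the
   odd sum at m + 1, which [VS] supplies. *)
have [IHU _] := IHm N.+2 (ltnW mN).
rewrite big_ord_recl /=.
under eq_bigr do rewrite /bump /= add1n mulnSr addn2 addnS binS natrD mulrDl.
rewrite big_split /= addrA mulrDr.
move: IHU; rewrite big_ord_recl /=.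
under eq_bigr do rewrite /bump /= add1n mulnSr addn2 addnS -addSn.
rewrite muln0 !bin0 => ->.
have -> : \sum_(i < N.+1) 'C(m.+1 + i, (2 * i).+1)%:R * y ^+ (2 * i).+2 =
    y ^+ 2 * \sum_(i < N.+1) 'C(m.+1 + i, (2 * i).+1)%:R * y ^+ (2 * i).
  rewrite mulr_sumr; apply: eq_bigr => i _.
  by rewrite !exprS; ring.
have -> t (S : R) : t * (y ^+ 2 * S) = y * (t * y * S) by ring.
rewrite VS // mulnSr addn2 /y !exprS.
by field; rewrite expf_neq0.
Qed.

(** * Closed forms of the integral and of P_m *)

Lemma N04E (a : R) m : -1 < a -> let c := 2 * (a + 1) in
  N04 m a = \sum_(j < m.+1) 'C(m + j, 2 * j)%:R *
    (pi / 2 / Num.sqrt c / c ^+ (m - j) * (dfact j * dfact (m - j))%:R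
      / (2 ^ m * m`!)%:R).
Proof.
move=> a_gt c; have c0 : 0 < c by rewrite /c; lra.
have Q0 (x : R) : 0 < x ^+ 4 + 2 * a * x ^+ 2 + 1.
  have -> : x ^+ 4 + 2 * a * x ^+ 2 + 1 = (x ^+ 2 - 1) ^+ 2 + c * x ^+ 2.
    by rewrite /c; ring.
  have [->|x0] := eqVneq x 0.
    by rewrite expr0n /= mulr0 sub0r sqrrN expr1n addr0.
  by rewrite ltr_wpDl ?sqr_ge0 // mulr_gt0 // exprn_even_gt0.
have Ig : has_integral0y (fun y => \sum_(j < m.+1) 'C(m + j, 2 * j)%:R *
    (y ^+ (2 * j) / (y ^+ 2 + c) ^+ m.+1)) (\sum_(j < m.+1) 'C(m + j, 2 * j)%:R *
    (pi / 2 / Num.sqrt c / c ^+ (m - j) * (dfact j * dfact (m - j))%:R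
      / (2 ^ m * m`!)%:R)).
  apply: has_integral0y_sum => j; apply: has_integral0yZ.
  have := has_integral0y_quot j (m - j) c0.
  by rewrite subnKC // -ltnS.
apply: Rintegral_fold_inv Ig _.
- move=> x; apply: cvgV; first by rewrite expf_neq0 // gt_eqF.
  have cQ : (z : R) ^+ 4 + 2 * a * z ^+ 2 + 1 @[z --> x] -->
      x ^+ 4 + 2 * a * x ^+ 2 + 1.
    apply: cvgD; last exact: cvg_cst.
    apply: cvgD; first exact: exprn_continuous.
    by apply: cvgMr; exact: exprn_continuous.
  exact: (cvg_comp _ _ cQ (@exprn_continuous _ m.+1 _)).
- by move=> x; rewrite invr_ge0 exprn_ge0 // ltW.
(* With y = x - 1/x, the quartic equals x^2 (y^2 + c) at x and x^-2 (y^2 + c) at 1/x, so the two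
   folded terms share the denominator (y^2 + c)^(m+1). *)
move=> x x0; have xn0 : x != 0 by rewrite gt_eqF.
under [X in _ = _ * X]eq_bigr do rewrite mulrA.
rewrite -mulr_suml.
have -> : 1 + (x ^+ 2)^-1 = x^-1 * (x + x^-1) by field.
rewrite -[RHS]mulrA [X in x^-1 * X]mulrA (sum_bin_sub_inv xn0 (ltnSn m)).1.
have -> : (x - x^-1) ^+ 2 + c = (x ^+ 4 + 2 * a * x ^+ 2 + 1) / x ^+ 2.
  by rewrite /c; field.
have -> : x^-1 ^+ 4 + 2 * a * x^-1 ^+ 2 + 1 = (x ^+ 4 + 2 * a * x ^+ 2 + 1) / x ^+ 4.
  by field.
rewrite !expr_div_n; set W := (_ + 1) ^+ m.+1.
have W0 : W != 0 by rewrite expf_neq0 // gt_eqF.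
have -> : (x ^+ 4) ^+ m.+1 = x ^+ 4 * (x ^+ (2 * m)) ^+ 2.
  by rewrite -!exprM -exprD; congr (_ ^+ _); lia.
have -> : (x ^+ 2) ^+ m.+1 = x ^+ 2 * x ^+ (2 * m).
  by rewrite -!exprM -exprD; congr (_ ^+ _); lia.
rewrite (exprS x (2 * m)); have X0 : x ^+ (2 * m) != 0 by rewrite expf_neq0.
by field; rewrite W0 X0 xn0.
Qed.

(** The prefactor equals (2 / pi) c^m sqrt(c) with c = 2 (a + 1): it cancels pi / 2 and the square
    root, and turns c^-(m-j) into c^j. *)
Lemma PfunE (a : R) m : -1 < a ->
  Defs.Pfun m a = \sum_(j < m.+1)
    ('C(m + j, 2 * j) * (dfact j * dfact (m - j)))%:R / (2 ^ m * m`!)%:R *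
    (2 * (a + 1)) ^+ j.
Proof.
move=> a_gt; rewrite /Defs.Pfun N04E //; set c := 2 * (a + 1).
have c0 : 0 < c by rewrite /c; lra.
have a0 : 0 < a + 1 by lra.
have sn0 : Num.sqrt c != 0 by rewrite gt_eqF // sqrtr_gt0.
have cE : c `^ (m%:R + 1 / 2) = c ^+ m * Num.sqrt c.
  rewrite powRD; last by rewrite (gt_eqF c0) implybT.
  by rewrite powR_mulrn ?ltW // mul1r powR12_sqrt ?ltW.
have -> : 2 `^ (m%:R + 3 / 2) / pi * (a + 1) `^ (m%:R + 1 / 2) =
    2 / pi * (c ^+ m * Num.sqrt c).
  rewrite -cE powRM ?ltW //.
  have -> : m%:R + 3 / 2 = 1 + (m%:R + 1 / 2) :> R by field.
  rewrite powRD ?powRr1 //; last by rewrite pnatr_eq0 implybT.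
  by rewrite !mulrA; congr (_ * _); rewrite mulrAC.
rewrite mulr_sumr; apply: eq_bigr => j _.
have -> : c ^+ m = c ^+ (m - j) * c ^+ j by rewrite -exprD subnK // -ltnS.
have pin0 : pi != 0 :> R by rewrite gt_eqF ?pi_gt0.
have cj0 : c ^+ (m - j) != 0 by rewrite expf_neq0 // gt_eqF.
rewrite [('C(_, _) * _)%:R]natrM.
have fact_nz : m`!%:R != 0 :> R by rewrite pnatr_eq0 -lt0n fact_gt0.
have exp_nz : (2 ^ m)%:R != 0 :> R by rewrite pnatr_eq0 -lt0n expn_gt0.
move: (pi : R) pin0 => p p0.
by field; rewrite fact_nz exp_nz cj0 sn0 p0.
Qed.

End Integral.

(** * Identification of the polynomial and the valuation *)

(** A nonzero difference would have as many distinct roots as its size, one more than its degree. *)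
Lemma horner_natr_inj (R : numDomainType) (p q : {poly R}) :
  (forall n : nat, p.[n%:R] = q.[n%:R]) -> p = q.
Proof.
move=> pq; apply/eqP; rewrite -subr_eq0; apply/negPn/negP => pq0.
have := @max_poly_roots R _ [seq n%:R | n <- iota 0 (size (p - q))] pq0.
rewrite size_map size_iota ltnn => H.
suff : false by [].
apply: H.
  by apply/allP => _ /mapP[n _ ->]; rewrite /root hornerD hornerN pq subrr.
by rewrite map_inj_uniq ?iota_uniq // => i j /eqP; rewrite eqr_nat => /eqP.
Qed.

Lemma represents_Pexplicit (R : realType) m : represents_P R m (Pexplicit m).
Proof.
split=> [|a a_gt]; first exact: size_Pexplicit.
rewrite PfunE // rmorph_sum horner_sum; apply: eq_bigr => j _ /=.
rewrite map_polyZ hornerZ rmorphXn /= map_polyZ.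
rewrite [map_poly _ (_ + _)]rmorphD /= map_polyX map_polyC.
by rewrite !hornerE /= fmorph_div !rmorph_nat rmorph1.
Qed.

(** As a representing polynomial exists, [xget] returns one. It agrees with [Pexplicit] at all
    natural numbers, which lie in ]-1, +oo[, and [ratr] is injective on coefficients. *)
Lemma Ppoly_explicit (R : realType) m : Ppoly R m = Pexplicit m.
Proof.
have [_ PE] := represents_Pexplicit R m.
have [_ PP] : represents_P R m (Ppoly R m).
  exact: (xgetI 0 (represents_Pexplicit R m)).
apply: (@map_poly_inj _ R ratr).
apply: horner_natr_inj => n; rewrite -PE -?PP //;
  exact: lt_le_trans (ltrN10 _) (ler0n _ _).
Qed.

Theorem theorem4 (R : realType) (m : nat) (m_gt0 : (0 < m)%N) :
  d R 1 m != 0 /\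
  nu2 (d R 1 m) =
    1 - 2 * m%:Z + nu2 (('C(m.+1, 2))%:R : rat) + (s2 m)%:Z.
Proof.
have odd_gt := odd_gt0 (odd_oddsum m_gt0).
have num_gt0 : (0 < m * m.+1 * oddsum m)%N by rewrite !muln_gt0 m_gt0 odd_gt.
have den_gt0 : (0 < 2 ^ m * m`!)%N by rewrite muln_gt0 expn_gt0 fact_gt0.
rewrite /d Ppoly_explicit Pexplicit1 //; split.
  by rewrite mulf_neq0 ?invr_eq0 // pnatr_eq0 -lt0n.
have bin_gt : (0 < 'C(m.+1, 2))%N by rewrite bin_gt0; lia.
(* The factor 2 here is the source of the summand 1 in the formula. *)
have mE : (m * m.+1 = 2 * 'C(m.+1, 2))%N by rewrite -mul_bin_diag bin1 mulnC.
rewrite nu2_div // -['C(m.+1, 2)%:R]divr1 (nu2_div bin_gt (ltn0Sn 0)) logn1.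
have odd_log : logn 2 (oddsum m) = 0%N.
  by rewrite lognE dvdn2 odd_oddsum // andbF.
rewrite mE !lognM ?expn_gt0 ?fact_gt0 // ?muln_gt0 ?bin_gt // odd_log.
rewrite pfactorK // logn_prime //.
(* The denominator has valuation m + (m - s2(m)). *)
have := logn2_fact m; lia.
Qed.
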